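(* Let $L\ge 1$ be an integer, let $\delta,\zeta>0$, and for $l=1,\dots,L$ let $\alpha_l>0$, $\beta_l>0$. For each $\rho>0$ let $\gamma_1,\dots,\gamma_L$ be independent nonnegative random variables, where $\gamma_l$ has cumulative distribution function $F_{\gamma_l}(\gamma)=\frac{1}{1+(\gamma/(\rho\alpha_l))^{-\beta_l}}$ for $\gamma>0$, let $f_{\gamma_{SC}}$ be the probability density function of $\gamma_{SC}=\max\{\gamma_1,\dots,\gamma_L\}$, and let $$\overline{P_e}(\rho)=\int_0^\infty\delta\,\mathrm{erfc}\left(\sqrt{\zeta\gamma}\right)f_{\gamma_{SC}}(\gamma)\,d\gamma$$ be the average bit error rate. Put $S_\beta=\sum_{l=1}^L\beta_l$ and $\varphi=\prod_{l=1}^L\left(\frac{1}{\alpha_l}\right)^{\beta_l}$. Then, as $\rho\to\infty$, $$\overline{P_e}(\rho)\sim\frac{\delta\,\zeta^{-S_\beta}}{\sqrt\pi}\,\varphi\,\Gamma\left(\tfrac12+S_\beta\right)\rho^{-S_\beta}.$$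
   Context: The complementary error function is $\mathrm{erfc}(x)=\frac{2}{\sqrt\pi}\int_x^\infty e^{-t^2}dt$. The notation $a(\rho)\sim b(\rho)$ as $\rho\to\infty$ means $a(\rho)/b(\rho)\to1$. In the application, $\gamma_l$ is the SNR of the $l$-th branch of a selection combining receiver, $\rho$ is the average transmit SNR, and $\delta,\zeta$ are modulation-dependent parameters. *)

(* Defs.v *)
From HB Require Import structures.
From mathcomp Require Import all_boot all_order all_algebra.
From mathcomp Require Import all_classical all_reals all_analysis.
From mathcomp Require Import measurable_realfun.

Set Implicit Arguments.
Unset Strict Implicit.
Unset Printing Implicit Defensive.
Import Order.TTheory GRing.Theory Num.Theory.
Import numFieldNormedType.Exports.

Local Open Scope classical_set_scope.
Local Open Scope ring_scope.

Definition erfc (R : realType) (x : R) : R :=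
  2 / Num.sqrt pi *
  \int[@lebesgue_measure R]_(t in `[x, +oo[) expR (- t ^+ 2).

(* Euler's integral; it is Gamma only for 0 < z (the integral diverges, and
   [Rintegral] returns a junk value, for z <= 0). *)
Definition Gamma (R : realType) (z : R) : R :=
  \int[@lebesgue_measure R]_(t in `]0, +oo[) (t `^ (z - 1) * expR (- t)).

(* Mutual independence of a finite family of real random variables. *)
Definition mutually_independent (d : measure_display) (T : measurableType d)
    (R : realType) (P : probability T R) (I : finType)
    (X : I -> {RV P >-> R}) : Prop :=
  forall (J : {set I}) (A : I -> set R),
    (forall i, i \in J -> measurable (A i)) ->
    (P (\bigcap_(i in [set i | i \in J]) (X i @^-1` A i)) =
     \prod_(i in J) P (X i @^-1` A i))%E.

(* [f] is (a version of) the density of [X] w.r.t. Lebesgue measure. *)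
Definition is_pdf (d : measure_display) (T : measurableType d)
    (R : realType) (P : probability T R) (X : {RV P >-> R}) (f : R -> R) :
    Prop :=
  [/\ measurable_fun setT f,
      forall x, 0 <= f x &
      forall A : set R, measurable A ->
        distribution P X A = (\int[@lebesgue_measure R]_(x in A) (f x)%:E)%E].

Section selection_combining.
Context (d : measure_display) (T : measurableType d) (R : realType)
  (P : probability T R) (L : nat).

(* The base value 0 of the iterated maximum is harmless when the branches are
   nonnegative and 0 < L. *)
Definition selection_combining (X : 'I_L -> {RV P >-> R}) : T -> R :=
  fun w => \big[Num.max/0]_(l < L) X l w.

Lemma measurable_selection_combining (X : 'I_L -> {RV P >-> R}) :
  measurable_fun setT (selection_combining X).
Proof.
rewrite /selection_combining; elim: (index_enum _) => [|l s IH].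
  by under eq_fun do rewrite big_nil; exact: measurable_cst.
under eq_fun do rewrite big_cons.
by apply: measurable_maxr.
Qed.

HB.instance Definition _ (X : 'I_L -> {RV P >-> R}) :=
  isMeasurableFun.Build _ _ _ _ (selection_combining X)
    (measurable_selection_combining X).

End selection_combining.

(* Average bit error rate when the received SNR has density [f]. *)
Definition average_ber (R : realType) (delta zeta : R) (f : R -> R) : R :=
  \int[@lebesgue_measure R]_(g in `]0, +oo[)
    (delta * erfc (Num.sqrt (zeta * g)) * f g).

(* Main.v *)
Require Import Defs.
From HB Require Import structures.
From mathcomp Require Import all_boot all_order all_algebra.
From mathcomp Require Import all_classical all_reals all_analysis.
From mathcomp Require Import measurable_realfun ring lra.
Import Order.TTheory GRing.Theory Num.Theory.
Import numFieldNormedType.Exports.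
Local Open Scope classical_set_scope.
Local Open Scope ring_scope.

(* By Tonelli, the average of [erfc (sqrt (zeta g))] against the density is the
   integral over [t > 0] of [2 / sqrt pi * exp (- t^2) * G (t^2 / zeta)], where
   the distribution function [G] of the maximum is a product by independence.
   Since [rho^b / (1 + (x / (rho a))^-b) = 1 / (rho^-b + (x / a)^-b)], the
   integrand multiplied by [rho^S] is dominated by its limit, which is a multiple
   of [t^(2 S) exp (- t^2)], and dominated convergence applies. The substitution
   [u = t^2] turns the limiting integral into [Gamma (1/2 + S)]. *)

(** * Distribution function of the maximum *)

(** The event that the maximum is at most [x] is the intersection of the branch events, and
    independence over the full index set factors its probability. The sign of [x] matters because
    the iterated maximum starts from 0. *)
Lemma cdf_selection_combining (d : measure_display) (T : measurableType d)
    (R : realType) (P : probability T R) (L : nat) (X : 'I_L -> {RV P >-> R})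
    (x : R) :
  mutually_independent X -> 0 <= x ->
  (cdf (selection_combining X : {RV P >-> R}) x = \prod_(l < L) cdf (X l) x)%E.
Proof.
move=> indX x0.
have := indX [set: 'I_L]%SET (fun=> `]-oo, x]%classic) (fun i _ => measurable_itv _).
under eq_bigl do rewrite finset.in_setT.
move=> <-; rewrite /cdf /distribution /pushforward /=; congr (P _).
apply/seteqP; split => w /=; rewrite in_itv/=.
  by move=> /bigmax_leP[_ Xx] l _ /=; rewrite in_itv/= Xx.
move=> Xx; apply/bigmax_leP; split=> // l _.
by have := Xx l; rewrite /= in_itv/=; apply; rewrite finset.in_setT.
Qed.

Lemma selection_combining_ge0 (d : measure_display) (T : measurableType d)
    (R : realType) (P : probability T R) (L : nat) (X : 'I_L -> {RV P >-> R}) w :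
  0 <= selection_combining X w.
Proof. by rewrite /selection_combining; apply/bigmax_geP; left. Qed.

(** A law with a density gives no mass to the point 0, so for nonnegative [X] the open left endpoint
    loses nothing; for [x < 0] both sides vanish. *)
Lemma integral_pdf_cdf (d : measure_display) (T : measurableType d)
    (R : realType) (P : probability T R) (X : {RV P >-> R}) (f : R -> R)
    (x : R) :
  is_pdf X f -> (forall w, 0 <= X w) ->
  (\int[@lebesgue_measure R]_(g in `]0%R, x]) (f g)%:E = cdf X x)%E.
Proof.
move=> [mf f0 pf] X0; rewrite -pf//.
have PX0 : distribution P X [set 0] = 0%E by rewrite pf// integral_set1.
have [x0|x0] := leP 0 x; last first.
  rewrite /cdf [in LHS]set_itv_ge ?measure0 -?leNgt ?bnd_simp ?ltW//.
  rewrite /distribution /pushforward/= (_ : _ @^-1` _ = set0) ?measure0//.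
  apply/seteqP; split => w//=; rewrite in_itv/= => Xx.
  by have := le_lt_trans (le_trans (X0 w) Xx) x0; rewrite ltxx.
(* The null mass of the point 0 is added back, so that the two sides become probabilities of the
   same event. *)
rewrite -[LHS]add0e -PX0 -measureU//; last first.
  by rewrite -subset0 => y /= [->]; rewrite in_itv/= ltxx.
rewrite /cdf /distribution /pushforward/=; congr (P _).
apply/seteqP; split => w /=; rewrite !in_itv/=.
  by case=> [->|/andP[]].
by move=> ->; have := X0 w; rewrite le_eqVlt => /predU1P[|->]; [left|right].
Qed.

(** * The error rate as an integral of the distribution function *)

(** Since [erfc] is a tail integral, the rate is a double integral over [sqrt (zeta g) <= t], and
    the exchange leaves [g <= t^2 / zeta] inside. Extended integrals under a single [fine] let
    Tonelli run on nonnegativity and measurability of the integrand alone. *)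
Lemma average_berE (R : realType) (delta zeta : R) (f : R -> R) :
  0 < delta -> 0 < zeta -> measurable_fun setT f -> (forall x, 0 <= f x) ->
  average_ber delta zeta f =
  fine (\int[@lebesgue_measure R]_(t in `]0%R, +oo[)
    ((delta * (2 / Num.sqrt pi) * expR (- t ^+ 2))%:E *
     \int[@lebesgue_measure R]_(g in `]0%R, (t ^+ 2 / zeta)%R]) (f g)%:E))%E.
Proof.
move=> d0 z0 mf f0; congr fine.
set mu := @lebesgue_measure R.
pose c := delta * (2 / Num.sqrt pi).
have c0 : 0 <= c by rewrite mulr_ge0 ?(ltW d0)// divr_ge0// sqrtr_ge0.
(* The indicator of the region moves both domains of integration into the integrand, which then
   lives on the whole plane. *)
pose b (p : R * R) : bool := (0 < p.1) && (Num.sqrt (zeta * p.1) <= p.2).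
pose h (p : R * R) : R := c * (expR (- p.2 ^+ 2) * f p.1) * (b p)%:R.
have h0 p : 0 <= h p.
  by rewrite /h mulr_ge0// mulr_ge0// mulr_ge0// expR_ge0.
(* The same region seen at fixed [t]: a positive square root forces [0 < t], and then the inequality
   may be squared. *)
have bE g t : b (g, t) = (0 < t) && (0 < g <= t ^+ 2 / zeta).
  rewrite /b/=; have [g0|] := ltP 0 g; last by rewrite andbF.
  have sg0 : 0 < Num.sqrt (zeta * g) by rewrite sqrtr_gt0 mulr_gt0.
  have [t0|t0]/= := ltP 0 t; last first.
    by apply/negbTE; rewrite -ltNge (le_lt_trans t0).
  rewrite ler_pdivlMr// [g * _]mulrC.
  by rewrite -{1}(ger0_norm (ltW t0)) -sqrtr_sqr ler_sqrt ?sqr_ge0.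
have mh : measurable_fun setT h.
  apply: measurable_funM; last first.
    apply: measurableT_comp => //; apply: measurable_and.
      exact: measurable_fun_ltr.
    apply: measurable_fun_ler => //.
    apply: measurableT_comp; first exact: continuous_measurable_fun (@sqrt_continuous R).
    exact: measurable_funM.
  apply: measurable_funM => //; apply: measurable_funM; last exact: measurableT_comp.
  apply: measurableT_comp => //; apply: measurableT_comp => //.
  by apply: measurable_funX.
transitivity (\int[mu]_g \int[mu]_t (h (g, t))%:E)%E.
  rewrite integral_mkcond; apply: eq_integral => g _; rewrite patchE.
  case: ifPn => [|]; rewrite ?inE/= ?notin_setE/= in_itv/= andbT => g0; last first.
    rewrite integral0_eq// => t _; rewrite /h /b/=.
    by move/negP/negbTE : g0 => ->; rewrite mulr0.
  have cf0 : 0 <= c * f g by rewrite mulr_ge0.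
  transitivity ((c * f g)%:E * \int[mu]_(t in `[Num.sqrt (zeta * g), +oo[) (expR (- t ^+ 2))%:E)%E.
    (* [erfc] is built on a real-valued integral, which agrees with the extended one once the
       Gaussian tail is known to be finite. *)
    have fin : (\int[mu]_(t in `[Num.sqrt (zeta * g), +oo[) (expR (- t ^+ 2))%:E \is a fin_num)%E.
      apply: integrable_fin_num => //.
      exact: (integrableS measurableT _ _ (@integrableT_gauss R)).
    rewrite -(fineK fin) -EFinM; congr EFin.
    by rewrite /erfc /Rintegral /c; rewrite -/mu; ring.
  rewrite -ge0_integralZl_EFin//; last first.
    by apply/measurable_EFinP/measurable_funTS; exact: measurable_gauss_fun.
  rewrite integral_mkcond; apply: eq_integral => t _; rewrite patchE /h /b/= g0/=.
  case: ifPn => [|]; rewrite ?inE/= ?notin_setE/= in_itv/= andbT => gt.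
    by rewrite gt mulr1 -EFinM; congr EFin; ring.
  by move/negP/negbTE : gt => ->; rewrite mulr0.
transitivity (\int[mu]_t \int[mu]_g (h (g, t))%:E)%E.
  apply: (fubini_tonelli (m1 := mu) (m2 := mu) (EFin \o h)).
    exact/measurable_EFinP.
  by move=> p; rewrite lee_fin.
rewrite [RHS]integral_mkcond; apply: eq_integral => t _; rewrite patchE.
case: ifPn => [|]; rewrite ?inE/= ?notin_setE/= in_itv/= andbT => t0; last first.
  rewrite integral0_eq// => g _; rewrite /h bE/=.
  by move/negP/negbTE : t0 => ->; rewrite mulr0.
rewrite -ge0_integralZl_EFin//; last 3 first.
- by move=> g _; rewrite lee_fin.
- exact/measurable_EFinP/measurable_funTS.
- by rewrite mulr_ge0// expR_ge0.
rewrite [RHS]integral_mkcond; apply: eq_integral => g _; rewrite patchE /h bE/= t0/=.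
case: ifPn => [|]; rewrite ?inE/= ?notin_setE/= in_itv/= => gt.
  by rewrite gt mulr1 -EFinM -/c mulrA.
by move/negP/negbTE : gt => ->; rewrite mulr0.
Qed.

(** * Gaussian form of Euler's integral *)

(** The substitution of [x^2] for [t], whose derivative supplies [2 * x]. It is stated for extended
    integrals of nonnegative functions, so infinite values are covered too. *)
Lemma integral_Gamma_gauss (R : realType) (z : R) :
  (\int[@lebesgue_measure R]_(t in `]0%R, +oo[) (t `^ (z - 1) * expR (- t))%:E =
   \int[@lebesgue_measure R]_(t in `]0%R, +oo[)
     (2 * t `^ (2 * z - 1) * expR (- t ^+ 2))%:E)%E.
Proof.
set mu := @lebesgue_measure R.
pose G t : R := t `^ (z - 1) * expR (- t).
pose H t : R := 2 * t `^ (2 * z - 1) * expR (- t ^+ 2).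
(* The substitution is made on [[1/(n+1), n+1]], since [t `^ (z - 1)] may blow up at 0. *)
pose a n : R := n.+1%:R^-1.
pose b n : R := n.+1%:R.
have a0 n : 0 < a n by rewrite invr_gt0.
have ab n : a n <= b n.
  by rewrite (@le_trans _ _ 1)// ?invf_le1// ler1n.
(* The exponent [k.+1] serves both variables: [k = 0] exhausts the half-line for [H], and [k = 1]
   does so for [G], on the squared intervals. *)
have cover (k : nat) :
    \bigcup_n `[(a n) ^+ k.+1, (b n) ^+ k.+1]%classic = `]0, +oo[%classic :> set R.
  apply/seteqP; split => x /=.
    move=> [n _] /=; rewrite !in_itv/= andbT => /andP[+ _].
    by apply: lt_le_trans; rewrite exprn_gt0.
  rewrite in_itv/= andbT => x0.
  (* With this [n], [n.+1] exceeds both [x] and [x^-1]; as [n.+1] is at least 1, raising it to a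
     power keeps the bounds. *)
  exists (maxn (Num.trunc x) (Num.trunc x^-1)) => //=; rewrite in_itv/=; apply/andP; split.
    rewrite exprVn invf_ple ?posrE ?exprn_gt0//.
    rewrite (@le_trans _ _ (b (maxn (Num.trunc x) (Num.trunc x^-1))))//.
      rewrite (le_trans (ltW (truncnS_gt x^-1)))// /b ler_nat ltnS leq_maxr//.
    by rewrite -[leLHS]expr1 ler_weXn2l// /b ler1n.
  rewrite (@le_trans _ _ (b (maxn (Num.trunc x) (Num.trunc x^-1))))//.
    rewrite (le_trans (ltW (truncnS_gt x)))// /b ler_nat ltnS leq_maxl//.
  by rewrite -[leLHS]expr1 ler_weXn2l// /b ler1n.
have mono (k : nat) : nondecreasing_seq (fun n => `[(a n) ^+ k.+1, (b n) ^+ k.+1]%classic : set R).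
  move=> m n mn; apply/subsetPset; apply: subset_itv; rewrite bnd_simp.
    by rewrite lerXn2r ?nnegrE ?(ltW (a0 _))// lef_pV2 ?posrE ?ltr0n ?ler_nat.
  by rewrite lerXn2r ?nnegrE ?ler0n// ler_nat ltnS.
have sub n (x : R) : x \in `[a n, b n] -> 0 < x.
  by rewrite in_itv/= => /andP[+ _]; exact: lt_le_trans.
have mG D : measurable D -> measurable_fun D (EFin \o G).
  move=> mD; apply/measurable_EFinP/measurable_funTS; apply: measurable_funM.
    exact: measurable_powR.
  by apply: measurableT_comp => //; exact: measurableT_comp.
have mH D : measurable D -> measurable_fun D (EFin \o H).
  move=> mD; apply/measurable_EFinP/measurable_funTS; apply: measurable_funM.
    by apply: measurable_funM => //; exact: measurable_powR.
  exact: measurable_gauss_fun.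
have G0 x : (0 <= (G x)%:E)%E by rewrite lee_fin mulr_ge0 ?powR_ge0 ?expR_ge0.
have H0 x : (0 <= (H x)%:E)%E.
  by rewrite lee_fin mulr_ge0 ?expR_ge0// mulr_ge0 ?powR_ge0.
have cG : (\int[mu]_(x in `[((a n) ^+ 2)%R, ((b n) ^+ 2)%R]) (G x)%:E @[n --> \oo] -->
           \int[mu]_(x in `]0%R, +oo[) (G x)%:E)%E.
  rewrite -(cover 1%N); apply: ge0_nondecreasing_set_cvg_integral => // n; exact: mG.
have cH : (\int[mu]_(x in `[((a n) ^+ 1)%R, ((b n) ^+ 1)%R]) (H x)%:E @[n --> \oo] -->
           \int[mu]_(x in `]0%R, +oo[) (H x)%:E)%E.
  rewrite -(cover 0%N); apply: ge0_nondecreasing_set_cvg_integral => // n; exact: mH.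
(* Both integrals are limits of truncated integrals, so it suffices that the truncations agree for
   each [n]. *)
apply: cvg_unique cG _ => //.
suff <- : (fun n => \int[mu]_(x in `[((a n) ^+ 1)%R, ((b n) ^+ 1)%R]) (H x)%:E)%E =
  (fun n => \int[mu]_(x in `[((a n) ^+ 2)%R, ((b n) ^+ 2)%R]) (G x)%:E)%E by [].
apply/funext => n; rewrite !expr1.
pose F (x : R) := x ^+ 2.
have dF x : is_derive x (1 : R) F (2 * x).
  apply: DeriveDef; first exact: exprn_derivable.
  by rewrite exp_derive [LHS]mulr1 expr1.
have F'E : F^`()%classic = (fun x : R => 2 * x).
  by apply/funext => x; rewrite derive1E; exact: derive_val.
have cF' : continuous (F^`()%classic).
  rewrite F'E => x; exact: mulrl_continuous.
have cF : continuous F by exact: exprn_continuous.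
rewrite -[a n ^+ 2]/(F (a n)) -[b n ^+ 2]/(F (b n)).
rewrite (@integration_by_substitution_increasing R F G)//.
- apply: eq_integral => x; rewrite inE/= => /sub x0.
  rewrite !fctE F'E /G /H /F; congr EFin.
  rewrite -[x ^+ 2]powR_mulrn ?(ltW x0)// -powRrM.
  (* The extra factor [x] is the one coming from the derivative [2 * x]. *)
  have -> : 2 * z - 1 = 2 * (z - 1) + 1 by ring.
  rewrite powRD; last by rewrite (gt_eqF x0) implybT.
  by rewrite powRr1 ?(ltW x0)//; ring.
- move=> x y /sub x0 /sub y0 xy.
  by rewrite /F ltrXn2r ?nnegrE ?(ltW x0) ?(ltW y0).
- by apply/cvg_ex; exists (F^`()%classic (a n)); apply: cvg_at_right_filter; exact: cF'.
- by apply/cvg_ex; exists (F^`()%classic (b n)); apply: cvg_at_left_filter; exact: cF'.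
- split.
  + by move=> x _.
  + by apply: cvg_at_right_filter; exact: cF.
  + by apply: cvg_at_left_filter; exact: cF.
- apply/continuous_in_subspaceT => x; rewrite inE/= in_itv/= => /andP[ax _].
  have x0 : 0 < x by apply: lt_le_trans ax; rewrite exprn_gt0.
  have cP : {for x, continuous (fun t : R => t `^ (z - 1))}.
    by apply: differentiable_continuous; apply/derivable1_diffP/derivable_powR; rewrite in_itv/= x0.
  have cE : {for x, continuous (fun t : R => expR (- t))}.
    by apply: continuous_comp; [exact: opp_continuous|exact: continuous_expR].
  exact: continuousM cP cE.
Qed.

Lemma integrable_powR_gauss (R : realType) (p : R) : 0 <= p ->
  (@lebesgue_measure R).-integrable `]0, +oo[
    (EFin \o (fun t => t `^ p * expR (- t ^+ 2))).
Proof.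
move=> p0.
(* From [ln t <= t] and [(t - (p + 1) / 2)^2 >= 0], [t^p exp (- t^2) <= M exp (- t)]. *)
pose M := expR ((p + 1) ^+ 2 / 4).
have iexp : (@lebesgue_measure R).-integrable `]0, +oo[
    (fun t => (M%:E * (exponential_pdf 1 t)%:E)%E).
  apply: integrableZl => //.
  apply: (integrableS measurableT) (integrable_exponential_pdf ltr01) => //.
apply: le_integrable iexp => //.
  apply/measurable_EFinP/measurable_funTS; apply: measurable_funM.
    exact: measurable_powR.
  exact: measurable_gauss_fun.
move=> t /=; rewrite in_itv/= andbT => t0.
rewrite lee_fin !ger0_norm ?mulr_ge0 ?expR_ge0 ?powR_ge0 ?exponential_pdf_ge0//.
rewrite exponential_pdfE ?(ltW t0)// mulN1r mul1r.
rewrite /powR gt_eqF// /M -!expRD ler_expR.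
have lnt : p * ln t <= p * t by rewrite ler_wpM2l// ltW// ln_sublinear.
have := sqr_ge0 (t - (p + 1) / 2).
by move: lnt; set u := ln t; nra.
Qed.

(** In the Gaussian form the exponent [2 * z - 1] is nonnegative, so the integral is finite and
    [fine] preserves its positivity. The result allows division by the constant of the
    asymptotics. *)
Lemma Gamma_gt0 (R : realType) (z : R) : 1 / 2 <= z -> 0 < Gamma z.
Proof.
move=> z2; rewrite /Gamma /Rintegral integral_Gamma_gauss.
set mu := @lebesgue_measure R.
pose H t : R := 2 * t `^ (2 * z - 1) * expR (- t ^+ 2).
have iH : mu.-integrable `]0, +oo[ (EFin \o H).
  have p0 : 0 <= 2 * z - 1 by lra.
  have -> : EFin \o H = (fun t => 2%:E * (t `^ (2 * z - 1) * expR (- t ^+ 2))%:E)%E.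
    by apply/funext => t; rewrite /H /= -EFinM mulrA.
  by apply: integrableZl => //; exact: integrable_powR_gauss.
have H0 x : (0 <= (H x)%:E)%E.
  by rewrite lee_fin mulr_ge0 ?expR_ge0// mulr_ge0 ?powR_ge0.
have mH : measurable_fun (`]0, +oo[ : set R) (EFin \o H) by case/integrableP: iH.
have fH : (\int[mu]_(t in `]0%R, +oo[) (H t)%:E \is a fin_num)%E.
  by apply: integrable_fin_num.
apply: fine_gt0; rewrite ltey_eq fH andbT.
have s12 : `[1, 2]%classic `<=` (`]0, +oo[%classic : set R).
  by move=> x /=; rewrite !in_itv/= => /andP[x1 _]; rewrite (lt_le_trans ltr01).
apply: (@lt_le_trans _ _ (\int[mu]_(t in `[1%R, 2%R]) (H t)%:E)%E); last first.
  by apply: ge0_subset_integral.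
(* On [[1, 2]] the power of [x] is at least 1 and [x^2] is at most 4. *)
apply: (@lt_le_trans _ _ (\int[mu]_(t in `[1%R, 2%R]) cst (expR (- 4))%:E t)%E).
  rewrite integral_cst//= lebesgue_measure_itv/= lte_fin ltr1n -EFinB -EFinM lte_fin.
  by rewrite mulr_gt0 ?expR_gt0// subr_gt0 ltr1n.
apply: ge0_le_integral => //.
- by move=> x _; rewrite lee_fin expR_ge0.
- exact: measurable_funS mH.
move=> x; rewrite /= in_itv/= => /andP[x1 x2]; rewrite lee_fin.
rewrite /H -[leLHS]mul1r ler_pM ?expR_ge0//.
  suff : 1 <= x `^ (2 * z - 1) by lra.
  by rewrite -[leLHS](powRr0 x) ler_powR//; lra.
by rewrite ler_expR; nra.
Qed.

(** * Limits as a real parameter tends to infinity *)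

Lemma cvg_powRNy (R : realType) (b : R) : 0 < b ->
  x `^ (- b) @[x --> +oo] --> (0 : R).
Proof.
move=> b0; apply/cvgrPdist_le => /= e e0; near=> x.
(* The threshold is the solution of [x^-b = e]. *)
have e1 : 0 < e^-1 `^ b^-1 by apply: powR_gt0; rewrite invr_gt0.
have x1 : e^-1 `^ b^-1 <= x by near: x; exact: nbhs_pinfty_ge.
have x0 : 0 < x by exact: lt_le_trans e1 x1.
rewrite sub0r normrN ger0_norm ?powR_ge0// powRN.
rewrite invf_ple ?posrE ?powR_gt0//.
have -> : e^-1 = (e^-1 `^ b^-1) `^ b.
  by rewrite -powRrM mulVf ?gt_eqF// powRr1// invr_ge0 ltW.
by rewrite ge0_ler_powR ?nnegrE ?(ltW b0) ?(ltW e1) ?(ltW x0).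
Unshelve. all: by end_near. Qed.

(** A limit at [+oo] can be tested along all sequences [u] tending to [+oo], and along each of them
    the sequential dominated convergence theorem applies. *)
Lemma cvg_Rintegral_dominatedy (d : measure_display) (T : measurableType d)
    (R : realType) (mu : {measure set T -> \bar R}) (D : set T)
    (f : R -> T -> R) (h g : T -> R) :
  measurable D -> (forall r, measurable_fun D (f r)) -> measurable_fun D h ->
  mu.-integrable D (EFin \o g) ->
  (forall r t, D t -> `|f r t| <= g t) ->
  (forall t, D t -> f r t @[r --> +oo] --> h t) ->
  (\int[mu]_(t in D) f r t)%R @[r --> +oo] --> (\int[mu]_(t in D) h t)%R.
Proof.
move=> mD mf mh ig fg fh; apply/cvg_pinftyP => u uy.
have mu_ n : measurable_fun D (EFin \o f (u n)) by exact/measurable_EFinP.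
have mh_ : measurable_fun D (EFin \o h) by exact/measurable_EFinP.
have fh_ : {ae mu, forall t, D t ->
    (EFin \o f (u n)) t @[n --> \oo] --> (EFin \o h) t}.
  apply: aeW => t Dt; apply/cvg_EFin; first exact: nearW.
  exact: (cvg_pinftyP _ _).1 (fh t Dt) u uy.
have fg_ : {ae mu, forall t n, D t ->
    (`|(EFin \o f (u n)) t| <= (EFin \o g) t)%E}.
  by apply: aeW => t n Dt; rewrite /= lee_fin fg.
have [ih _] := dominated_convergence mD mu_ mh_ fh_ ig fg_.
have fin : (\int[mu]_(t in D) (h t)%:E \is a fin_num)%E.
  exact: integrable_fin_num ih.
by rewrite /= -(fineK fin); exact: fine_cvg.
Qed.

Lemma powR_sum (R : realType) (x : R) (I : Type) (r : seq I) (P : pred I)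
    (F : I -> R) : x != 0 ->
  x `^ (\sum_(i <- r | P i) F i) = \prod_(i <- r | P i) x `^ F i.
Proof.
move=> x0; apply: (big_morph (powR x)); last exact: powRr0.
by move=> a b; rewrite powRD// x0 implybT.
Qed.

Lemma measurable_fun_powR (R : realType) (q : R) (f : R -> R) :
  measurable_fun setT f -> measurable_fun setT (fun t => f t `^ q).
Proof. by move=> mf; exact: (measurableT_comp (measurable_powR q) mf). Qed.

(** * Asymptotics of the average bit error rate *)

Theorem mainTheorem8 (R : realType) (L : nat) (hL : (0 < L)%N)
    (delta zeta : R) (hdelta : 0 < delta) (hzeta : 0 < zeta)
    (alpha beta : 'I_L -> R)
    (halpha : forall l, 0 < alpha l) (hbeta : forall l, 0 < beta l)
    (d : R -> measure_display)
    (T : forall rho : R, measurableType (d rho))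
    (P : forall rho : R, probability (T rho) R)
    (gamma : forall rho : R, 'I_L -> {RV (P rho) >-> R})
    (hindep : forall rho, 0 < rho -> mutually_independent (gamma rho))
    (hnonneg : forall rho, 0 < rho -> forall l w, 0 <= gamma rho l w)
    (hcdf : forall rho, 0 < rho -> forall l x, 0 < x ->
       cdf (gamma rho l) x =
         (1 / (1 + (x / (rho * alpha l)) `^ (- beta l)))%:E)
    (f_SC : R -> R -> R)
    (hpdf : forall rho, 0 < rho ->
       is_pdf (selection_combining (gamma rho) : {RV (P rho) >-> R})
              (f_SC rho)) :
  let S_beta := \sum_(l < L) beta l in
  let phi := \prod_(l < L) (1 / alpha l) `^ beta l in
  average_ber delta zeta (f_SC rho) /
    (delta * zeta `^ (- S_beta) / Num.sqrt pi * phi *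
     Gamma (1 / 2 + S_beta) * rho `^ (- S_beta))
    @[rho --> +oo] --> (1 : R).
Proof.
move=> S phi.
have S0 : 0 <= S by apply: sumr_ge0 => l _; exact: ltW.
set mu := @lebesgue_measure R.
set K := Gamma (1 / 2 + S).
have K0 : 0 < K by apply: Gamma_gt0; lra.
have sqpi0 : 0 < Num.sqrt pi :> R by rewrite sqrtr_gt0 pi_gt0.
pose c := delta * (2 / Num.sqrt pi).
have c0 : 0 < c by rewrite mulr_gt0// divr_gt0.
have phi0 : 0 < phi by apply: prodr_gt0 => l _; rewrite powR_gt0// divr_gt0.
pose y l (t : R) := (t ^+ 2 / zeta / alpha l) `^ (- beta l).
have y0 l t : 0 < t -> 0 < y l t.
  by move=> t0; rewrite powR_gt0// !divr_gt0// exprn_gt0.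
(* [H rho] is the integrand of [rho ^ S * BER(rho)] and [h] its pointwise limit. *)
pose H rho t := c * expR (- t ^+ 2) * \prod_(l < L) (rho `^ (- beta l) + y l t) `^ (-1).
pose h t := c * zeta `^ (- S) * phi * (t `^ (2 * S) * expR (- t ^+ 2)).
(* In this form [h] is [H rho] with the terms [rho^-beta] dropped, so the two can be compared factor
   by factor. *)
have hE t : 0 < t -> h t = c * expR (- t ^+ 2) * \prod_(l < L) (y l t) `^ (-1).
  move=> t0.
  have -> : \prod_(l < L) (y l t) `^ (-1) =
      \prod_(l < L) (t `^ (2 * beta l) * zeta `^ (- beta l) * (1 / alpha l) `^ beta l).
    apply: eq_bigr => l _.
    rewrite /y -powRrM mulrN1 opprK div1r.
    rewrite -[t ^+ 2]powR_mulrn ?(ltW t0)//.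
    rewrite !powRM ?divr_ge0 ?invr_ge0 ?powR_ge0 ?(ltW hzeta) ?(ltW (halpha l))//.
    by rewrite -powRrM powRN -powR_inv1 ?(ltW hzeta)// -powRrM mulN1r powRN.
  rewrite !big_split/= -/phi -!powR_sum ?gt_eqF//.
  by rewrite -mulr_sumr sumrN -/S /h; ring.
have ih : mu.-integrable `]0, +oo[ (EFin \o h).
  have -> : EFin \o h = (fun t => (c * zeta `^ (- S) * phi)%:E *
      (t `^ (2 * S) * expR (- t ^+ 2))%:E)%E by [].
  apply: integrableZl => //; apply: integrable_powR_gauss; lra.
have mH rho : measurable_fun (`]0, +oo[ : set R) (H rho).
  apply: measurable_funTS; apply: measurable_funM.
    by apply: measurable_funM => //; exact: measurable_gauss_fun.
  apply: measurable_prod => l _.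
  apply: measurable_fun_powR; apply: (measurable_funD (f := fun=> _) (g := y l)) => //.
  apply: measurable_fun_powR.
  by do 2! apply: measurable_funM => //; exact: measurable_funX.
have H0 rho t : 0 <= H rho t.
  apply: mulr_ge0; first exact: mulr_ge0 (ltW c0) (expR_ge0 _).
  by apply: prodr_ge0 => l _; exact: powR_ge0.
(* Adding the nonnegative [rho^-beta] to each denominator only lowers the product, so one majorant
   serves every [rho]. *)
have Hh rho t : 0 < t -> H rho t <= h t.
  move=> t0; rewrite hE// /H ler_wpM2l ?(mulr_ge0 (ltW c0) (expR_ge0 _))//.
  apply: ler_prod => l _; rewrite powR_ge0/= !powR_inv1 ?addr_ge0 ?powR_ge0 ?(ltW (y0 _ _ t0))//.
  by rewrite lef_pV2 ?posrE ?ltr_wpDl ?lerDr ?powR_ge0 ?y0.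
have iH rho : mu.-integrable `]0, +oo[ (EFin \o H rho).
  apply: le_integrable ih => //; first by apply/measurable_EFinP; exact: mH.
  move=> t /=; rewrite in_itv/= andbT => t0.
  by rewrite lee_fin ger0_norm// ger0_norm ?Hh// (le_trans (H0 rho t))// Hh.
have cvgH : (\int[mu]_(t in `]0, +oo[) H rho t) @[rho --> +oo] -->
            (\int[mu]_(t in `]0, +oo[) h t).
  apply: (cvg_Rintegral_dominatedy _ _ _ mu _ H h h) => //.
  - by case/integrableP: ih => /measurable_EFinP.
  - by move=> rho t /=; rewrite in_itv/= andbT => t0; rewrite ger0_norm// Hh.
  move=> t /=; rewrite in_itv/= andbT => t0; rewrite hE// /H.
  apply: cvgM; first exact: cvg_cst.
  apply: cvg_big; first exact: mul_continuous.
  move=> l _; rewrite powR_inv1 ?powR_ge0//.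
  under eq_fun do rewrite powR_inv1 ?addr_ge0 ?powR_ge0//.
  apply: cvgV; first by rewrite gt_eqF// y0.
  rewrite -[X in _ --> X]add0r; apply: cvgD; last exact: cvg_cst.
  exact: cvg_powRNy.
pose A := delta * zeta `^ (- S) / Num.sqrt pi * phi * K.
have A0 : 0 < A by rewrite !mulr_gt0 ?invr_gt0 ?powR_gt0.
have inthE : \int[mu]_(t in `]0, +oo[) h t = A.
  have ig : mu.-integrable `]0, +oo[ (EFin \o (fun t => t `^ (2 * S) * expR (- t ^+ 2))).
    by apply: integrable_powR_gauss; lra.
  rewrite /h RintegralZl// /A.
  (* The factor 2 of the Gaussian form absorbs the 2 of [2 / sqrt pi] in [c]; at [z = 1/2 + S] the
     exponent [2 * z - 1] is [2 * S]. *)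
  have -> : K = 2 * \int[mu]_(t in `]0, +oo[) (t `^ (2 * S) * expR (- t ^+ 2)).
    rewrite -RintegralZl// /K /Gamma /Rintegral integral_Gamma_gauss; congr fine.
    apply: eq_integral => t _.
    have -> : 2 * (1 / 2 + S) - 1 = 2 * S by field.
    by rewrite mulrA.
  by rewrite /c; ring.
(* An exact identity: all the decay is in [rho^-S], and the remaining integral converges. *)
have berE rho : 0 < rho ->
    average_ber delta zeta (f_SC rho) = rho `^ (- S) * \int[mu]_(t in `]0, +oo[) H rho t.
  move=> r0; have [mf f0 _] := hpdf rho r0.
  rewrite average_berE// -RintegralZl//; congr fine.
  apply: eq_integral => t; rewrite inE/= in_itv/= andbT => t0.
  have x0 : 0 < t ^+ 2 / zeta by rewrite divr_gt0// exprn_gt0.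
  rewrite (integral_pdf_cdf _ _ _ _ _ _ _ (hpdf rho r0)); last exact: selection_combining_ge0.
  rewrite cdf_selection_combining; [|exact: hindep|exact: ltW].
  under eq_bigr do rewrite hcdf//.
  rewrite prodEFin -EFinM; congr EFin.
  (* Each factor releases one [rho^-beta], and together these make up [rho^-S]. *)
  have -> : \prod_(l < L) (1 / (1 + (t ^+ 2 / zeta / (rho * alpha l)) `^ (- beta l))) =
     \prod_(l < L) (rho `^ (- beta l) * (rho `^ (- beta l) + y l t) `^ (-1)).
    apply: eq_bigr => l _.
    rewrite powR_inv1 ?addr_ge0 ?powR_ge0// invfM mulrCA.
    have xa0 := ltW (divr_gt0 x0 (halpha l)).
    rewrite [X in 1 + X]powRM ?xa0 ?invr_ge0 ?(ltW r0)//.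
    have rb : 0 < rho `^ beta l by rewrite powR_gt0.
    rewrite -/(y l t) -[rho^-1]powR_inv1 ?(ltW r0)// -powRrM mulrN mulN1r opprK powRN.
    have := y0 l t t0; set Y := y l t => Y0.
    by field; rewrite !gt_eqF//= addr_gt0// mulr_gt0.
  by rewrite big_split/= -powR_sum ?gt_eqF// sumrN -/S /H -/c; ring.
have : (\int[mu]_(t in `]0, +oo[) H rho t) / A @[rho --> +oo] --> (1 : R).
  have -> : 1 = (\int[mu]_(t in `]0, +oo[) h t) / A by rewrite inthE divff ?gt_eqF.
  by apply: cvgM => //; exact: cvg_cst.
(* For [rho > 0] the powers [rho^-S] cancel, so the two ratios are eventually equal. *)
apply: cvg_trans; apply: near_eq_cvg; near=> rho.
have r0 : 0 < rho by near: rho; exact: nbhs_pinfty_gt.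
have rS : 0 < rho `^ (- S) by rewrite powR_gt0.
rewrite berE// -/A; field.
by rewrite !gt_eqF.
Unshelve. all: by end_near. Qed.
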